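(* Let $u,v$ be two distinct vertices of a simple connected graph $G$ of order $n$. Suppose that $v_{1},v_{2},\ldots,v_{s}$ $(1\leq s\leq d(v))$ are vertices of $N_{G}(v)\setminus N_{G}(u)$, all different from $u$. Let $G'=G-vv_{1}-vv_{2}-\cdots-vv_{s}+uv_{1}+uv_{2}+\cdots+uv_{s}$, and let $f$ be a harmonic eigenfunction associated with $\rho(\mathcal{L}(G))$. If $f(u)=f(v)$, then $\rho(\mathcal{L}(G))\leq\rho(\mathcal{L}(G'))$.
   Context: $N_G(x)$ is the set of neighbours of $x$ in $G$ and $d(x)$ its degree. For a simple graph $G$, $A$ is its adjacency matrix, $D$ the diagonal degree matrix, $L=D-A$ its Laplacian and $\mathcal{L}(G)=D^{-1/2}LD^{-1/2}$ its normalized Laplacian; $\rho(\mathcal{L}(G))$ is its spectral radius, i.e. its largest eigenvalue. Functions $f:V(G)\to\mathbb{R}$ are viewed as vectors; $e$ is the all-ones vector and $f\perp De$ means $\sum_x d(x)f(x)=0$. With $R(f)=\frac{\sum_{xy\in E(G)}(f(x)-f(y))^2}{\sum_{x}d(x)f(x)^2}$, one has $\rho(\mathcal{L}(G))=\sup_{f\neq0,\,f\perp De}R(f)$; a harmonic eigenfunction associated with $\rho(\mathcal{L}(G))$ is a nonzero $f\perp De$ with $R(f)=\rho(\mathcal{L}(G))$. *)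

(* Defs.v *)
From HB Require Import structures.
From mathcomp Require Import all_boot all_order all_algebra.
From mathcomp Require Import boolp classical_sets reals.

Set Implicit Arguments.
Unset Strict Implicit.
Unset Printing Implicit Defensive.

Import Order.TTheory GRing.Theory Num.Theory.

Local Open Scope ring_scope.

Record sgraph (n : nat) := SGraph {
  adj :> rel 'I_n;
  adj_sym : symmetric adj;
  adj_irr : irreflexive adj }.

Section Graph.
Variable n : nat.
Implicit Types (G : sgraph n) (E : seq ('I_n * 'I_n)).

Definition nbhd G (x : 'I_n) : {set 'I_n} := [set y | G x y].

Definition degree G (x : 'I_n) : nat := #|nbhd G x|.

Definition connected G : Prop := forall x y : 'I_n, connect G x y.

(* The pairs listed in E are read as unordered edges. *)
Definition in_edges E : rel 'I_n :=
  fun x y => ((x, y) \in E) || ((y, x) \in E).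

Definition del_edges_rel G E : rel 'I_n :=
  fun x y => G x y && ~~ in_edges E x y.

(* The guard [x != y] keeps the graph loopless: a pair (x, x) in E is ignored. *)
Definition add_edges_rel G E : rel 'I_n :=
  fun x y => G x y || (x != y) && in_edges E x y.

Lemma in_edges_sym E : symmetric (in_edges E).
Proof. by move=> x y; rewrite /in_edges orbC. Qed.

Lemma del_edges_sym G E : symmetric (del_edges_rel G E).
Proof. by move=> x y; rewrite /del_edges_rel adj_sym in_edges_sym. Qed.

Lemma del_edges_irr G E : irreflexive (del_edges_rel G E).
Proof. by move=> x; rewrite /del_edges_rel adj_irr. Qed.

Lemma add_edges_sym G E : symmetric (add_edges_rel G E).
Proof. by move=> x y; rewrite /add_edges_rel adj_sym in_edges_sym eq_sym. Qed.

Lemma add_edges_irr G E : irreflexive (add_edges_rel G E).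
Proof. by move=> x; rewrite /add_edges_rel adj_irr eqxx. Qed.

Definition del_edges G E : sgraph n :=
  SGraph (@del_edges_sym G E) (@del_edges_irr G E).

Definition add_edges G E : sgraph n :=
  SGraph (@add_edges_sym G E) (@add_edges_irr G E).

End Graph.

Section Spectral.
Variables (R : realType) (n : nat).
Implicit Types (G : sgraph n) (f : {ffun 'I_n -> R}).

Definition adjmx G : 'M[R]_n := \matrix_(x, y) (G x y)%:R.

Definition degmx G : 'M[R]_n := diag_mx (\row_x (degree G x)%:R).

Definition laplacian G : 'M[R]_n := degmx G - adjmx G.

(* D^(-1/2); as 0^-1 = 0, its entry at an isolated vertex is 0, which is the
   usual convention for the normalized Laplacian. *)
Definition degmx_rsqrt G : 'M[R]_n :=
  diag_mx (\row_x (Num.sqrt (degree G x)%:R)^-1).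

Definition nlaplacian G : 'M[R]_n :=
  degmx_rsqrt G *m laplacian G *m degmx_rsqrt G.

(* Largest (real) eigenvalue. A symmetric real matrix of positive size has a
   finite nonempty set of real eigenvalues, so that this supremum is a maximum;
   for a positive semidefinite matrix such as the normalized Laplacian it is
   the spectral radius. *)
Definition rho (M : 'M[R]_n) : R := sup [set a | eigenvalue M a]%classic.

(* Each edge is counted once, as the pair (x, y) with x < y. *)
Definition rayleigh G f : R :=
  (\sum_(x < n) \sum_(y < n | (x < y)%N && G x y) (f x - f y) ^+ 2)
  / (\sum_(x < n) (degree G x)%:R * f x ^+ 2).

Definition harmonic_eigenfunction G f : Prop :=
  [/\ f != 0,
      \sum_(x < n) (degree G x)%:R * f x = 0
    & rayleigh G f = rho (nlaplacian G)].

End Spectral.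

(* Main.v *)
(** Test the normalized Laplacian of G' on the function f itself. As f(u) = f(v),
    moving the neighbours v_i from v to u changes neither the sum of
    (f(x) - f(y))^2 over the edges nor the sum of d(x) f(x)^2, so that f has the
    same Rayleigh quotient in G' as in G, namely rho(L(G)). Any Rayleigh quotient
    is at most rho: it is the value at D^(1/2) f of the quadratic form of the
    symmetric normalized Laplacian, bounded by the largest eigenvalue through the
    spectral theorem. *)
Require Import Defs.
From HB Require Import structures.
From mathcomp Require Import all_boot all_order all_algebra.
From mathcomp Require Import boolp classical_sets reals.
From mathcomp Require Import complex polyrcf.
From mathcomp Require Import ring.

Set Implicit Arguments.
Unset Strict Implicit.
Unset Printing Implicit Defensive.

Import Order.TTheory GRing.Theory Num.Theory.

Local Open Scope ring_scope.

Section QuadraticForm.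
Local Open Scope sesquilinear_scope.

(* The spectral theorem of spectral.v is stated over an algebraically closed
   field, so A is diagonalized over R[i]; its diagonal is real. *)
Lemma symmetric_form_le (R : rcfType) n (A : 'M[R]_n) (b : R) (v : 'rV[R]_n) :
    A^T = A -> (forall a, eigenvalue A a -> a <= b) ->
  (v *m A *m v^T) 0 0 <= b * (v *m v^T) 0 0.
Proof.
move=> A_sym A_le; pose C : numClosedFieldType := complex.complex R.
pose toC : {rmorphism R -> C} := real_complex R.
have realC m p (B : 'M[R]_(m, p)) : map_mx toC B \is a mxOver Num.real.
  by apply/mxOverP => i j; rewrite mxE; apply/complex_realP; exists (B i j).
set Ac := map_mx toC A.
have Ac_herm : Ac \is hermsymmx.
  apply: realsym_hermsym (realC _ _ _); apply/is_hermitianmxP.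
  by rewrite expr0 scale1r map_mx_id // /Ac map_trmx A_sym.
have /orthomx_spectralP := hermitian_normalmx Ac_herm.
have /mxOverP d_real := hermitian_spectral_diag_real Ac_herm.
have P_unitary := spectral_unitarymx Ac; have P_unit := spectral_unit Ac.
move: d_real P_unitary P_unit.
set P := spectralmx Ac; set d := spectral_diag Ac => d_real P_unitary P_unit AcE.
(* Row [j] of the unitary [P] is a left eigenvector of [Ac] for [d 0 j], nonzero since [P] is
   invertible. As [d 0 j] is the image of a real [a], that [a] is already an eigenvalue of [A] over
   [R]. *)
have d_le j : d 0 j <= toC b.
  have /complex_realP [a dE] := d_real 0 j.
  rewrite dE lecR; apply: A_le.
  rewrite -(eigenvalue_map toC); apply/eigenvalueP; exists (row j P).
    rewrite -row_mul -/Ac AcE mulmxA mulKVmx // row_mul row_diag_mx.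
    by rewrite -scalemxAl -rowE dE.
  apply: contraTneq P_unit => Pj0; rewrite -row_free_unit; apply/row_freePn.
  by exists j; rewrite Pj0 sub0mx.
(* Coordinates of [v] in the eigenbasis. [formE] is used for [A] and for the identity, so that both
   sides become sums of squared moduli of the entries of [z], weighted by [d 0 j] and by [b]. *)
pose z := map_mx toC v *m P^t*.
have formE (B : 'M[R]_n) D : map_mx toC B = P^t* *m D *m P ->
    toC ((v *m B *m v^T) 0 0) = (z *m D *m z^t*) 0 0.
  move=> BE; transitivity ((map_mx toC (v *m B *m v^T)) 0 0); first by rewrite [RHS]mxE.
  have vE : map_mx toC v^T = (map_mx toC v)^t* by rewrite map_trmx realmxC.
  by rewrite !map_mxM BE vE /z trmx_mul map_mxM /= trmxCK !mulmxA.
have PPE : map_mx toC 1%:M = P^t* *m 1%:M *m P.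
  by rewrite map_mx1 mulmx1 -invmx_unitary // mulVmx.
have := formE _ _ PPE; rewrite !mulmx1 => vvE.
rewrite invmx_unitary // in AcE.
rewrite -lecR -[X in _ <= X]/(toC _) rmorphM /=.
rewrite [X in X <= _](formE _ _ AcE) [in X in _ <= X]vvE.
rewrite mul_mx_diag !mxE mulr_sumr; apply: ler_sum => j _; rewrite !mxE.
rewrite [_ * d _ _]mulrC -mulrA; apply: ler_wpM2r (d_le j).
exact: mul_conjC_ge0.
Qed.

End QuadraticForm.

(** A supremum dominates its set only when the set is bounded above; here the Cauchy bound on the
    roots of the characteristic polynomial provides this. *)
Lemma eigenvalue_le_rho (R : realType) n (A : 'M[R]_n) a :
  eigenvalue A a -> a <= rho A.
Proof.
move=> Aa; apply: ub_le_sup Aa; exists (cauchy_bound (char_poly A)) => x.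
rewrite /= eigenvalue_root_char => /rootP px0.
apply: le_trans (ler_norm x) (ltW _); apply: cauchy_boundP px0.
exact: monic_neq0 (char_poly_monic A).
Qed.

Lemma degree_sum (R : realType) n (G : sgraph n) (F : 'I_n -> R) :
  \sum_x (degree G x)%:R * F x = \sum_x \sum_(y | G x y) F x.
Proof.
apply: eq_bigr => x _; rewrite sumr_const mulr_natl; congr (_ *+ _).
by apply: eq_card => y; rewrite !inE.
Qed.

Lemma sum_adj_sym (R : realType) n (G : sgraph n) (F : 'I_n -> 'I_n -> R) :
  \sum_x \sum_(y | G x y) F x y = \sum_x \sum_(y | G x y) F y x.
Proof.
rewrite (exchange_big_dep predT) //=; apply: eq_bigr => x _.
by apply: eq_bigl => y; rewrite adj_sym.
Qed.

(** The ordered adjacent pairs split into those with [x < y] and those with [y < x], the diagonal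
    being excluded by irreflexivity. Sums over ordered pairs are easier to rearrange, so edge sums
    are doubled before being compared. *)
Lemma double_edge_sum (R : realType) n (G : sgraph n) (F : 'I_n -> 'I_n -> R) :
    (forall x y, F x y = F y x) ->
  \sum_x \sum_(y | G x y) F x y =
  2 * \sum_(x < n) \sum_(y < n | (x < y)%N && G x y) F x y.
Proof.
move=> F_sym; rewrite mulr2n mulrDl !mul1r.
rewrite [X in _ + X](exchange_big_dep predT) //= -big_split /=.
apply: eq_bigr => x _; rewrite (bigID (fun y : 'I_n => (x < y)%N)) /=.
congr (_ + _); first by apply: eq_bigl => y; rewrite andbC.
rewrite (eq_bigl (fun y : 'I_n => (y < x)%N && G y x)).
  by apply: eq_bigr => y _.
move=> y; rewrite -leqNgt leq_eqVlt adj_sym andbC.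
by case: eqP => [/val_inj->|_ //]; rewrite adj_irr ltnn.
Qed.

Lemma laplacian_form (R : realType) n (G : sgraph n) (h : 'rV[R]_n) :
  (h *m laplacian R G *m h^T) 0 0 =
  \sum_(x < n) \sum_(y < n | (x < y)%N && G x y) (h 0 x - h 0 y) ^+ 2.
Proof.
apply: (@mulfI _ 2); rewrite ?pnatr_eq0 // -double_edge_sum; last first.
  by move=> x y; rewrite -sqrrN opprB.
have -> : (h *m laplacian R G *m h^T) 0 0 = \sum_x (degree G x)%:R * h 0 x ^+ 2
    - \sum_x \sum_(y | G x y) h 0 x * h 0 y.
  rewrite mulmxBr mulmxBl mxE; congr (_ + _).
    rewrite mul_mx_diag mxE; apply: eq_bigr => x _; rewrite !mxE; ring.
  rewrite !mxE; congr (- _).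
  under eq_bigr => y _ do rewrite !mxE mulr_suml.
  rewrite exchange_big /=; apply: eq_bigr => x _; rewrite [RHS]big_mkcond /=.
  apply: eq_bigr => y _; rewrite !mxE.
  by case: (G x y); rewrite ?mulr1 // mulr0 mul0r.
(* Of the two copies of the degree sum, one keeps [h 0 x ^+ 2] and the other is reflected to
   [h 0 y ^+ 2]; the expanded square then matches term by term. *)
rewrite degree_sum mulrBr mulr_natl mulr2n {2}sum_adj_sym -big_split /=.
rewrite mulr_sumr -sumrB; apply: eq_bigr => x _.
rewrite mulr_sumr -big_split -sumrB; apply: eq_bigr => y _ /=; ring.
Qed.

Lemma degmx_rsqrt_sym (R : realType) n (G : sgraph n) :
  (degmx_rsqrt R G)^T = degmx_rsqrt R G.
Proof. exact: tr_diag_mx. Qed.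

Lemma nlaplacian_sym (R : realType) n (G : sgraph n) :
  (nlaplacian R G)^T = nlaplacian R G.
Proof.
rewrite /nlaplacian !trmx_mul degmx_rsqrt_sym mulmxA /laplacian linearB /=.
rewrite tr_diag_mx; congr (_ *m (_ - _) *m _).
by apply/matrixP => x y; rewrite !mxE adj_sym.
Qed.

Lemma rayleigh_le_rho (R : realType) n (G : sgraph n) (f : {ffun 'I_n -> R}) :
    0 < \sum_(x < n) (degree G x)%:R * f x ^+ 2 ->
  rayleigh G f <= rho (nlaplacian R G).
Proof.
move=> den_gt0; rewrite /rayleigh ler_pdivrMr //.
pose g : 'rV[R]_n := \row_x (Num.sqrt (degree G x)%:R * f x).
have := symmetric_form_le g (nlaplacian_sym R G) (@eigenvalue_le_rho R n _).
have -> : (g *m g^T) 0 0 = \sum_(x < n) (degree G x)%:R * f x ^+ 2.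
  by rewrite mxE; apply: eq_bigr => x _; rewrite !mxE -expr2 exprMn sqr_sqrtr ?ler0n.
(* The outer factors [degmx_rsqrt] are absorbed into the vectors, leaving the Laplacian form at
   [g *m degmx_rsqrt R G]. *)
rewrite /nlaplacian !mulmxA -[_ *m _ *m g^T]mulmxA.
rewrite -[X in X *m g^T]degmx_rsqrt_sym -trmx_mul laplacian_form.
apply: le_trans; rewrite le_eqVlt; apply/orP; left; apply/eqP.
(* At an isolated vertex the left side is 0 whatever [f x] is, but only endpoints of edges enter the
   sum. *)
have gE x : (0 < degree G x)%N -> (g *m degmx_rsqrt R G) 0 x = f x.
  move=> dx; rewrite mul_mx_diag !mxE mulrAC mulfV ?mul1r //.
  by rewrite gt_eqF // sqrtr_gt0 ltr0n.
apply: eq_bigr => x _; apply: eq_bigr => y /andP[_ xy].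
by rewrite !gE //; apply/card_gt0P; [exists x | exists y]; rewrite inE // adj_sym.
Qed.

Lemma connected_degree_gt0 n (G : sgraph n) (x y : 'I_n) :
  connected G -> x != y -> (0 < degree G x)%N.
Proof.
move=> conG xy; have /connectP[[|z p] /=] := conG x y.
  by move=> _ yx; rewrite yx eqxx in xy.
by move=> /andP[xz _] _; apply/card_gt0P; exists z; rewrite inE.
Qed.

Lemma in_edges_star n (a x y : 'I_n) (t : seq 'I_n) :
  in_edges [seq (a, z) | z <- t] x y =
  (x == a) && (y \in t) || (y == a) && (x \in t).
Proof.
have star p q : ((p, q) \in [seq (a, z) | z <- t]) = (p == a) && (q \in t).
  apply/mapP/andP => [[z zt [-> ->]]|[/eqP-> qt]]; first by rewrite eqxx.
  by exists q.
by rewrite /in_edges !star.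
Qed.

Section EdgeShift.
Variables (R : realType) (n : nat) (G : sgraph n) (u v : 'I_n) (t : seq 'I_n).
Hypothesis u_neq_v : u != v.
Hypothesis t_nbhd : forall x, x \in t -> x \in nbhd G v :\: nbhd G u.
Hypothesis t_neq_u : forall x, x \in t -> x != u.

Let G' := add_edges (del_edges G [seq (v, x) | x <- t]) [seq (u, x) | x <- t].

(** The identity is exact because every deleted edge was present and every added one absent. With
    values in [R], it makes the effect of the shift on any sum linear. *)
Lemma shift_adj x y :
  (G' x y)%:R = (G x y)%:R
    + ((x == u) && (y \in t))%:R + ((y == u) && (x \in t))%:R
    - ((x == v) && (y \in t))%:R - ((y == v) && (x \in t))%:R :> R.
Proof.
rewrite /= /add_edges_rel /= /del_edges_rel !in_edges_star.
have tP z : z \in t -> [/\ G v z, G z v, ~~ G u z, ~~ G z u & z != u /\ z != v].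
  move=> zt; have := t_nbhd zt; rewrite !inE => /andP[Nuz vz].
  split; rewrite ?(adj_sym G z) //; split; first exact: t_neq_u.
  by apply: contraTneq vz => ->; rewrite adj_irr.
have v_u : (v == u) = false by rewrite eq_sym; apply: negPf.
(* Since [t] contains neither [u] nor [v], adjacency can change only when exactly one of [x], [y]
   lies in [t] and the other is [u] or [v]. *)
have [xt|_] := boolP (x \in t); have [yt|_] := boolP (y \in t).
- have [_ _ _ _ [/negPf-> /negPf->]] := tP _ xt.
  have [_ _ _ _ [/negPf-> /negPf->]] := tP _ yt.
  by rewrite /= ?andbF ?orbF andbT !addr0 !subr0.
- have [vx xv ux xu [/negPf x_u /negPf x_v]] := tP _ xt.
  rewrite x_u x_v !andbF !andbT /=.
  have [->|_] := eqVneq y v.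
    by rewrite xv v_u andbF /= !addr0 subr0 subrr.
  have [->|_] := eqVneq y u.
    by rewrite (negPf xu) x_u /= addr0 add0r !subr0.
  by rewrite /= ?andbF ?orbF andbT !addr0 !subr0.
- have [vy yv uy yu [/negPf y_u /negPf y_v]] := tP _ yt.
  rewrite y_u y_v !andbF !andbT !orbF.
  have [->|_] := eqVneq x v.
    by rewrite vy v_u andbF /= !addr0 subr0 subrr.
  have [->|_] := eqVneq x u.
    by rewrite (negPf uy) (eq_sym u y) y_u /= add0r !subr0 addr0.
  by rewrite /= ?andbF ?orbF andbT !addr0 !subr0.
- by rewrite !andbF /= orbF andbT !addr0 !subr0.
Qed.

(** The four correction terms of [shift_adj] sum to rows and columns of [F] at [u] and [v] over [t],
    which cancel in pairs. This serves both the numerator and the denominator of the Rayleigh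
    quotient. *)
Lemma shift_sum (F : 'I_n -> 'I_n -> R) :
    (forall x, F x u = F x v) -> (forall y, F u y = F v y) ->
  \sum_x \sum_(y | G' x y) F x y = \sum_x \sum_(y | G x y) F x y.
Proof.
move=> Fr Fl.
have indE (e : rel 'I_n) : \sum_x \sum_(y | e x y) F x y
    = \sum_x \sum_y (e x y)%:R * F x y.
  apply: eq_bigr => x _; rewrite big_mkcond; apply: eq_bigr => y _.
  by case: (e x y); rewrite ?mul1r ?mul0r.
have rowE a : \sum_x \sum_y ((x == a) && (y \in t))%:R * F x y
    = \sum_(y in t) F a y.
  rewrite -(indE (fun x y => (x == a) && (y \in t))) (bigD1 a) //=.
  rewrite [X in _ + X]big1 ?addr0; first by apply: eq_bigl => y; rewrite eqxx.
  by move=> x /negPf xa; rewrite xa big_pred0.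
have colE a : \sum_x \sum_y ((y == a) && (x \in t))%:R * F x y
    = \sum_(x in t) F x a.
  rewrite [RHS]big_mkcond; apply: eq_bigr => x _.
  rewrite (bigD1 a) //= eqxx [X in _ + X]big1 ?addr0.
    by case: (x \in t); rewrite ?mul1r ?mul0r.
  by move=> y /negPf->; rewrite mul0r.
rewrite !indE; under eq_bigr => x _ do under eq_bigr => y _ do
  rewrite shift_adj !mulrBl !mulrDl.
under eq_bigr => x _ do rewrite !sumrB !big_split /=.
rewrite !sumrB !big_split /= !rowE !colE.
rewrite (eq_bigr _ (fun y _ => Fl y)) (eq_bigr _ (fun x _ => Fr x)); ring.
Qed.

End EdgeShift.

Theorem theorem4p3 (R : realType) (n : nat) (G : sgraph n) (u v : 'I_n)
    (s : nat) (w : s.-tuple 'I_n) (f : {ffun 'I_n -> R})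
    (G_connected : connected G)
    (u_neq_v : u != v)
    (s_bounds : (1 <= s <= degree G v)%N)
    (w_distinct : uniq w)
    (w_nbhd : forall x : 'I_n, x \in w -> x \in nbhd G v :\: nbhd G u)
    (w_neq_u : forall x : 'I_n, x \in w -> x != u)
    (f_harmonic : harmonic_eigenfunction G f)
    (f_uv : f u = f v) :
  let G' := add_edges (del_edges G [seq (v, x) | x <- w]) [seq (u, x) | x <- w] in
  rho (nlaplacian R G) <= rho (nlaplacian R G').
Proof.
set G' := add_edges _ _; have [f_neq0 _ <-] /= := f_harmonic.
have denE : \sum_(x < n) (degree G' x)%:R * f x ^+ 2
          = \sum_(x < n) (degree G x)%:R * f x ^+ 2.
  by rewrite !degree_sum shift_sum // => y; rewrite f_uv.
have numE : \sum_(x < n) \sum_(y < n | (x < y)%N && G' x y) (f x - f y) ^+ 2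
          = \sum_(x < n) \sum_(y < n | (x < y)%N && G x y) (f x - f y) ^+ 2.
  have sqC x y : (f x - f y) ^+ 2 = (f y - f x) ^+ 2 by rewrite -sqrrN opprB.
  apply: (@mulfI _ 2); rewrite ?pnatr_eq0 // -!double_edge_sum //.
  by rewrite shift_sum // => y; rewrite f_uv.
(* Every vertex differs from [u] or from [v], so connectedness gives it a neighbour. *)
have deg_gt0 x : (0 < degree G x)%N.
  have [xu|xu] := eqVneq x u; last exact: connected_degree_gt0 xu.
  by rewrite xu; exact: connected_degree_gt0 u_neq_v.
have -> : rayleigh G f = rayleigh G' f by rewrite /rayleigh numE denE.
(* Positivity is proved on the side of [G]: in [G'] the vertex [v] may have become isolated, whereas
   all degrees in [G] are positive. *)
apply: rayleigh_le_rho; rewrite denE lt_neqAle eq_sym.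
have term_ge0 x : 0 <= (degree G x)%:R * f x ^+ 2.
  by rewrite mulr_ge0 ?ler0n ?sqr_ge0.
rewrite sumr_ge0 // andbT; apply: contra f_neq0.
rewrite psumr_eq0 // => /allP f0; apply/eqP/ffunP => x; rewrite ffunE.
have := f0 x (mem_index_enum x).
by rewrite /= mulf_eq0 pnatr_eq0 gtn_eqF //= expf_eq0 /= => /eqP.
Qed.
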